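(* Let $n\geq 2$ and let $\mathbb{H}^{n}\times\mathbb{R}=\{(x,t)\in\mathbb{R}^{n}\times\mathbb{R}: x=(x_1,\dots,x_n),\ x_n>0\}$ be endowed with the metric $g=\frac{1}{x_{n}^{2}}\sum_{i=1}^{n}dx_{i}^{2}+dt^{2}$. Let $0<m<\infty$ be a constant, let $f$ be a smooth function on $\mathbb{H}^{n}\times\mathbb{R}$ and let $\lambda$ be a constant such that $$Ric+\nabla^{2}f-\frac{1}{m}\,df\otimes df=\lambda g,$$ where $Ric$ is the Ricci tensor of $g$ and $\nabla^2 f$ the Hessian of $f$ with respect to $g$. Then $\lambda=-(n-1)$ and, up to an additive constant, either $$f(x,t)=\pm\sqrt{(n-1)m}\;t,$$ or $$f(x,t)=-m\ln\big(\cosh(\eta t+a)\big)\quad\text{for some constant } a\in\mathbb{R},\ \text{where } \eta=\sqrt{\tfrac{n-1}{m}}.$$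
   Context: A Riemannian manifold $(M,g)$ with a smooth function $f$ and constants $m$, $\lambda$ satisfying $Ric+\nabla^{2}f-\frac{1}{m}df\otimes df=\lambda g$ is called a (gradient) quasi-Einstein metric. *)

(* Defs.v *)
From HB Require Import structures.
From mathcomp Require Import all_boot all_order all_algebra.
From mathcomp Require Import all_classical all_reals all_analysis.
Set Implicit Arguments. Unset Strict Implicit. Unset Printing Implicit Defensive.
Import Order.TTheory GRing.Theory Num.Theory.
Import numFieldNormedType.Exports.
Local Open Scope ring_scope.
Local Open Scope classical_set_scope.

(* Coordinates on H^n x R inside R^(n+1) = 'rV[R]_(n.+1):
   indices 0 .. n-1 are x_1 .. x_n, index n (ord_max) is t. *)
Section QE.
Variable R : realType.
Variable n : nat.
Notation V := 'rV[R]_(n.+1).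

Definition ecoord (i : 'I_n.+1) : V := \row_j (i == j)%:R.
Definition xn (p : V) : R := p ord0 (inord n.-1).
Definition tco (p : V) : R := p ord0 ord_max.
Definition Hdom : set V := [set p | 0 < xn p].

Definition pd (i : 'I_n.+1) (F : V -> R) : V -> R := fun p => 'D_(ecoord i) F p.
Definition iter_pd (s : seq 'I_n.+1) (F : V -> R) : V -> R := foldr pd F s.

Definition smooth_on (F : V -> R) : Prop :=
  forall (s : seq 'I_n.+1) (p : V), Hdom p ->
    {for p, continuous (iter_pd s F)} /\
    forall i, derivable (iter_pd s F) p (ecoord i).

Definition gmet (i j : 'I_n.+1) (p : V) : R :=
  if i == j then (if i == ord_max then 1 else (xn p ^+ 2)^-1) else 0.
Definition ginv (i j : 'I_n.+1) (p : V) : R :=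
  if i == j then (if i == ord_max then 1 else xn p ^+ 2) else 0.

Definition Gamma (k i j : 'I_n.+1) (p : V) : R :=
  2^-1 * \sum_(l < n.+1) ginv k l p *
    (pd i (gmet j l) p + pd j (gmet i l) p - pd l (gmet i j) p).

Definition Ric (i j : 'I_n.+1) (p : V) : R :=
  \sum_(k < n.+1) (pd k (Gamma k i j) p - pd j (Gamma k i k) p)
  + \sum_(k < n.+1) \sum_(l < n.+1)
      (Gamma k k l p * Gamma l i j p - Gamma k j l p * Gamma l i k p).

Definition Hess (F : V -> R) (i j : 'I_n.+1) (p : V) : R :=
  pd i (pd j F) p - \sum_(k < n.+1) Gamma k i j p * pd k F p.

Definition quasi_einstein (m lambda : R) (F : V -> R) : Prop :=
  forall p, Hdom p -> forall i j : 'I_n.+1,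
    Ric i j p + Hess F i j p - m^-1 * (pd i F p * pd j F p) = lambda * gmet i j p.
End QE.

Definition cosh {R : realType} (y : R) : R := (expR y + expR (- y)) / 2.

(* Main.v *)
Require Import Defs.
From HB Require Import structures.
From mathcomp Require Import all_boot all_order all_algebra.
From mathcomp Require Import all_classical all_reals all_analysis.
From mathcomp Require Import ring lra.
Set Implicit Arguments. Unset Strict Implicit. Unset Printing Implicit Defensive.
Import Order.TTheory GRing.Theory Num.Theory.
Import numFieldNormedType.Exports.
Local Open Scope ring_scope.
Local Open Scope classical_set_scope.

(** Put [u = exp (- f / m) > 0]; the equation becomes
    [Hess u = (u / m) (Ric - lambda g)], and only three kinds of components matter.
    - Along the geodesic [x_n = e^s] the [(x_n, x_n)] component reads
      [u'' = - (lambda + n - 1) / m * u]. A positive function on the line is not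
      strictly concave, so [lambda <= - (n - 1) < 0].
    - The [(x_i, t)] components say that [u_t] depends on [t] only, and the [(t, t)]
      component [u_tt = - (lambda / m) u] then gives the same for [u]. Hence [u] is
      constant along the geodesic above, and [lambda = - (n - 1)].
    - The [(t, t)] component is now [u'' = eta^2 u], so that
      [u = a e^(eta t) + b e^(- eta t)] with [a, b >= 0] by positivity. The cases
      [a = 0], [b = 0] and [a, b > 0] give the three families. *)

(** * Calculus on the line: concavity, linear ODEs with constant coefficients, sums of
    exponentials *)

Section RealFunctions.
Variable R : realType.
Implicit Types (G H K : R -> R) (a b s t x : R).

Lemma mean_value G H a b : a <= b ->
  (forall x, a <= x <= b -> is_derive x 1 G (H x)) ->
  exists2 c, a <= c <= b & G b - G a = H c * (b - a).
Proof.
move=> ab dG.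
have [||c] := @MVT_segment R G H a b ab; last by rewrite in_itv /=; exists c.
- move=> x; rewrite in_itv /= => /andP[ax xb]; apply: dG.
  by rewrite (ltW ax) (ltW xb).
- apply: derivable_within_continuous => x; rewrite in_itv /= => /dG dGx.
  exact: ex_derive.
Qed.

(** The graph of [G] lies below its tangents, and a tangent of nonzero slope reaches zero on one
    side. So [H] vanishes identically, against [K < 0]. *)
Lemma positive_concave_absurd G H K :
  (forall s, is_derive s 1 G (H s)) -> (forall s, is_derive s 1 H (K s)) ->
  (forall s, 0 < G s) -> (forall s, K s < 0) -> False.
Proof.
move=> dG dH G0 K0.
have H_le s t : s <= t -> H t <= H s.
  move=> st; have [c _] := mean_value st (fun x _ => dH x); have := K0 c; nra.
have H_ge0 s : 0 <= H s.
  rewrite leNgt; apply/negP => Hs.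
  (* [s + d] is where the tangent at [s] meets the axis. *)
  pose d := G s / - H s.
  have d0 : 0 < d by rewrite divr_gt0// oppr_gt0.
  have dE : H s * d = - G s by rewrite /d; field; rewrite lt_eqF.
  have sd : s <= s + d by lra.
  have [c /andP[sc _]] := mean_value sd (fun x _ => dG x).
  have := H_le _ _ sc; have := G0 (s + d); nra.
have H_le0 s : H s <= 0.
  rewrite leNgt; apply/negP => Hs.
  pose d := G s / H s.
  have d0 : 0 < d by rewrite divr_gt0.
  have dE : H s * d = G s by rewrite /d; field; rewrite gt_eqF.
  have sd : s - d <= s by lra.
  have [c /andP[_ sc]] := mean_value sd (fun x _ => dG x).
  have := H_le _ _ sc; have := G0 (s - d); nra.
have [c _] := mean_value ler01 (fun x _ => dH x).
have := K0 c; have := H_ge0 1; have := H_le0 0; nra.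
Qed.

Lemma is_derive_expR_linear (k t : R) :
  is_derive t 1 (fun s => expR (k * s)) (k * expR (k * t)).
Proof.
have dk : is_derive t 1 (k \*: @id R) k.
  by apply: is_derive_eq (is_deriveZ k (is_derive_id t 1)) _; rewrite /GRing.scale /= mulr1.
have := is_derive1_comp (is_derive_expR (k * t)) dk.
by rewrite mulrC.
Qed.

(** The product of [G t] with [expR (- k * t)] has zero derivative. *)
Lemma first_order_ode (k : R) G :
  (forall t, is_derive t 1 G (k * G t)) -> forall t, G t = G 0 * expR (k * t).
Proof.
move=> dG t.
pose P s := G s * expR (- k * s).
have dP s : is_derive s 1 P 0.
  have h : is_derive s 1 P _ := is_deriveM (dG s) (is_derive_expR_linear (- k) s).
  by apply: is_derive_eq h _; rewrite /GRing.scale /=; ring.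
have : P t = P 0 := is_derive_0_is_cst t 0 dP.
rewrite /P mulr0 expR0 mulr1 => <-.
by rewrite -mulrA -expRD mulNr addNr expR0 mulr1.
Qed.

(** The operator factors: for [k = eta] and [k = - eta], [H + k G] solves a first-order equation
    with rate [k]. The difference of the two solutions is [2 * eta * G]. *)
Lemma second_order_ode (eta : R) G H : eta != 0 ->
  (forall t, is_derive t 1 G (H t)) ->
  (forall t, is_derive t 1 H (eta ^+ 2 * G t)) ->
  exists a b, forall t, G t = a * expR (eta * t) + b * expR (- (eta * t)).
Proof.
move=> eta0 dG dH.
have ode k : k ^+ 2 = eta ^+ 2 ->
    forall t, H t + k * G t = (H 0 + k * G 0) * expR (k * t).
  move=> k2; apply: (@first_order_ode k (fun t => H t + k * G t)) => t.
  have h : is_derive t 1 (fun t => H t + k * G t) _ := is_deriveD (dH t) (is_deriveZ k (dG t)).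
  by apply: is_derive_eq h _; rewrite -k2 /GRing.scale /=; ring.
exists ((H 0 + eta * G 0) / (2 * eta)), (- (H 0 - eta * G 0) / (2 * eta)) => t.
have e1 := ode eta erefl t; have := ode (- eta) (sqrrN _) t.
rewrite !mulNr => e2.
have -> : G t = (H t + eta * G t - (H t - eta * G t)) / (2 * eta) by field.
by rewrite e1 e2; field.
Qed.

Lemma exp_combination_coef_ge0 (eta a b : R) : eta != 0 ->
  (forall t, 0 < a * expR (eta * t) + b * expR (- (eta * t))) -> 0 <= a.
Proof.
move=> eta0 pos; rewrite leNgt; apply/negP => a0.
(* At the [t] where [expR (eta * t)] squares to [x], the sum times [expR (eta * t)] is [a * x + b],
   that is [- |b| + a + b], which is at most [a < 0]. *)
pose x := `|b| / - a + 1.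
have x0 : 0 < x by rewrite ltr_wpDl// divr_ge0// oppr_ge0 ltW.
have := pos (ln x / (2 * eta)).
have -> : eta * (ln x / (2 * eta)) = ln x / 2 by field.
set E := expR _; have E0 : 0 < E := expR_gt0 _.
have EE : E * E = x by rewrite -expRD -splitr lnK.
rewrite expRN -/E => h.
have : 0 < (a * E + b / E) * E by rewrite mulr_gt0.
have -> : (a * E + b / E) * E = a * x + b by rewrite -EE; field; rewrite gt_eqF.
have -> : a * x = - `|b| + a by rewrite /x; field; rewrite lt_eqF.
have := ler_norm b; lra.
Qed.

(** Factoring out the geometric mean of [a] and [b] leaves reciprocal coefficients, which a shift of
    [y] absorbs. *)
Lemma ln_exp_combination (a b y : R) : 0 < a -> 0 < b ->
  ln (a * expR y + b * expR (- y)) =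
  ln (2 * (Num.sqrt a * Num.sqrt b)) +
  ln (cosh (y + (ln (Num.sqrt a) - ln (Num.sqrt b)))).
Proof.
move=> a0 b0.
have r0 : 0 < Num.sqrt a by rewrite sqrtr_gt0.
have s0 : 0 < Num.sqrt b by rewrite sqrtr_gt0.
rewrite -[in LHS](sqr_sqrtr (ltW a0)) -[in LHS](sqr_sqrtr (ltW b0)).
move: r0 s0; set r := Num.sqrt a; set s := Num.sqrt b => r0 s0.
rewrite -lnM ?posrE.
- congr ln; rewrite /cosh opprD opprB !expRD !expRN !lnK ?posrE//.
  have := expR_gt0 y; set E := expR y => E0.
  by field; rewrite !gt_eqF.
- by rewrite !mulr_gt0.
- by rewrite /cosh divr_gt0// addr_gt0// expR_gt0.
Qed.

End RealFunctions.

(** * Christoffel symbols, Ricci tensor and Hessian of the product metric *)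

Section Geometry.
Variables (R : realType) (n : nat).
Hypothesis n_gt0 : (0 < n)%N.
Local Notation V := 'rV[R]_(n.+1).
Local Notation Y := (inord n.-1 : 'I_n.+1).
Local Notation T := (@ord_max n).

Lemma Y_neq_T : (Y == T) = false.
Proof. by apply/eqP => /(congr1 val) /=; rewrite inordK ?prednK// => h; have := ltn_predL n; rewrite n_gt0 h ltnn. Qed.

Lemma xn_line (i : 'I_n.+1) (s : R) (p : V) :
  xn (s *: ecoord R i + p) = s * (i == Y)%:R + xn p.
Proof. by rewrite /xn !mxE. Qed.

Lemma tco_line (i : 'I_n.+1) (s : R) (p : V) :
  tco (s *: ecoord R i + p) = s * (i == T)%:R + tco p.
Proof. by rewrite /tco !mxE. Qed.

(** Metric coefficients and Christoffel symbols depend on [xn] alone, so this reduces their partial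
    derivatives to one variable. The difference quotients of the two sides already agree. *)
Lemma pd_xn (i : 'I_n.+1) (F : R -> R) (p : V) :
  pd i (F \o @xn R n) p = (i == Y)%:R * 'D_1 F (xn p).
Proof.
have lim_ext (g1 g2 : R -> R) : g1 =1 g2 -> lim (g1 @ 0^') = lim (g2 @ 0^').
  by move=> /funext ->.
rewrite /pd; have [->|iY] := eqVneq i Y.
  rewrite mul1r; apply: lim_ext => h /=.
  by rewrite xn_line eqxx mulr1 /GRing.scale /= mulr1.
rewrite mul0r; transitivity ('D_(ecoord R i) (cst (F (xn p))) p); last exact: derive_cst.
by apply: lim_ext => h /=; rewrite xn_line (negbTE iY) mulr0 add0r.
Qed.

Lemma derive_inv (y : R) : y != 0 -> 'D_1 (fun z : R => z^-1) y = - y ^- 2.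
Proof.
by move=> y0; rewrite (deriveV y0 (@derivable_id _ _ _ _)) derive_id /GRing.scale /= mulr1.
Qed.

Lemma derive_invsqr (y : R) : y != 0 -> 'D_1 (fun z : R => (z ^+ 2)^-1) y = - 2 * y ^- 3.
Proof.
move=> y0; have y20 : y ^+ 2 != 0 by rewrite expf_neq0.
rewrite (@deriveV _ _ (fun z : R => z ^+ 2) y 1 y20)//.
rewrite exp_derive /= expr1 /GRing.scale /= mulr1.
by field.
Qed.

Lemma pd_gmet (i j k : 'I_n.+1) (p : V) : xn p != 0 ->
  pd i (gmet j k) p = (i == Y)%:R * (j == k)%:R * (j != T)%:R * (- 2 * xn p ^- 3).
Proof.
move=> y0.
pose G (y : R) : R := if j == k then (if j == T then 1 else (y ^+ 2)^-1) else 0.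
rewrite (_ : gmet j k = G \o @xn R n) // pd_xn /G.
have [jk|jk] := eqVneq j k; last by rewrite derive_cst /=; ring.
have [jT|jT] := eqVneq j T; first by rewrite derive_cst /=; ring.
by rewrite derive_invsqr//=; ring.
Qed.

Lemma pd_gmet_T (i j k : 'I_n.+1) (p : V) :
  [|| i == T, j == T | k == T] -> pd i (gmet j k) p = 0.
Proof.
move=> h.
pose G (y : R) : R := if j == k then (if j == T then 1 else (y ^+ 2)^-1) else 0.
rewrite (_ : gmet j k = G \o @xn R n) // pd_xn.
move: h => /orP[/eqP->|h]; first by rewrite eq_sym Y_neq_T mul0r.
suff [c ->] : exists c : R, G = cst c by rewrite derive_cst mulr0.
rewrite /G; have [jk|jk] := eqVneq j k; last by exists 0.
by exists 1; move: h; rewrite -jk orbb => /eqP ->; rewrite eqxx.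
Qed.

(** [xn] times the symbols of the conformally flat metric with factor [exp (2 phi)],
    [phi = - ln xn]; the factors involving [T] remove the flat direction. *)
Definition christoffel (k i j : 'I_n.+1) : R :=
  (k != T)%:R * ((i == j)%:R * (i != T)%:R * (k == Y)%:R
    - (k == i)%:R * (j == Y)%:R - (k == j)%:R * (i == Y)%:R).

(* The identity also holds at [xn p = 0], where both sides are [0]. *)
Lemma GammaE (k i j : 'I_n.+1) (p : V) :
  Gamma k i j p = christoffel k i j * (xn p)^-1.
Proof.
rewrite /Gamma (bigD1 k)//= big1 ?addr0; last first.
  by move=> l lk; rewrite /ginv eq_sym (negbTE lk) mul0r.
rewrite /ginv eqxx /christoffel; have [kT|kT] := eqVneq k T.
  by rewrite kT !pd_gmet_T ?eqxx ?orbT//=; ring.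
have [y0|y0] := eqVneq (xn p) 0; first by rewrite y0 expr0n /= invr0; ring.
rewrite !pd_gmet//.
rewrite [j == k]eq_sym [i == k]eq_sym.
have [kj|kj] := eqVneq k j; have [ki|ki] := eqVneq k i;
  rewrite -?kj -?ki ?kT ?(negbTE ki) ?eqxx /=; by field.
Qed.

Lemma pd_Gamma (l k i j : 'I_n.+1) (p : V) : xn p != 0 ->
  pd l (Gamma k i j) p = (l == Y)%:R * (christoffel k i j * (- xn p ^- 2)).
Proof.
move=> y0; pose G (y : R) := christoffel k i j * y^-1.
rewrite (_ : Gamma k i j = G \o @xn R n); last by apply/funext => q; rewrite GammaE.
rewrite pd_xn; congr (_ * _).
rewrite -(derive_inv y0) /G.
by rewrite (@deriveZ _ _ _ (fun z : R => z^-1) (christoffel k i j))//; apply: derivableV.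
Qed.

(** The field d/dt is parallel in the product; this is why the components with an index [T] are so
    simple. *)
Lemma christoffel_T (k i : 'I_n.+1) : christoffel k i T = 0.
Proof.
rewrite /christoffel [T == Y]eq_sym Y_neq_T; have [_|_] := eqVneq k T; rewrite ?mul0r//.
by have [_|_] := eqVneq i T => /=; ring.
Qed.

Lemma christoffel_sym (k i j : 'I_n.+1) : christoffel k i j = christoffel k j i.
Proof.
rewrite /christoffel [j == i]eq_sym; have [->|_] := eqVneq i j => /=; ring.
Qed.

Lemma christoffel_Y (k i : 'I_n.+1) : christoffel k i Y = - (k != T)%:R * (k == i)%:R.
Proof.
rewrite /christoffel eqxx; have [->|iY] := eqVneq i Y; first by rewrite Y_neq_T /=; ring.
by rewrite /=; ring.
Qed.

Lemma christoffel_YY (k : 'I_n.+1) : christoffel k Y Y = - (k == Y)%:R.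
Proof.
rewrite christoffel_Y; have [->|_] := eqVneq k Y; rewrite ?Y_neq_T /=; ring.
Qed.

Lemma sum_neq_T : \sum_(k < n.+1) (k != T)%:R = n%:R :> R.
Proof.
rewrite (bigD1 T)//= eqxx add0r (eq_bigr (fun=> 1)); last by move=> k ->.
by rewrite sumr_const cardC1 card_ord.
Qed.

Lemma Ric_T (i : 'I_n.+1) (p : V) : xn p != 0 -> Ric i T p = 0.
Proof.
move=> y0; rewrite /Ric !big1 ?addr0// => k _.
  rewrite big1// => l _; rewrite !GammaE [christoffel k T l]christoffel_sym.
  by rewrite !christoffel_T; ring.
by rewrite !pd_Gamma// christoffel_T [T == Y]eq_sym Y_neq_T /=; ring.
Qed.

Lemma Ric_YY (p : V) : xn p != 0 -> Ric Y Y p = - n.-1%:R * xn p ^- 2.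
Proof.
move=> y0; rewrite /Ric sumrB; set y := xn p.
transitivity (y ^- 2 - n%:R * y ^- 2 + 0); last first.
  by move: n_gt0; case: n => // n' _; rewrite -natr1 /=; ring.
(* The divergence term gives [y ^- 2], the trace term [n * y ^- 2], and the quadratic terms cancel
   for each [k]. *)
congr (_ - _ + _).
- rewrite (bigD1 Y)//= big1 ?addr0; last first.
    by move=> k /negbTE kY; rewrite pd_Gamma// kY mul0r.
  by rewrite pd_Gamma// christoffel_YY eqxx /=; ring.
- rewrite -sum_neq_T mulr_suml; apply: eq_bigr => k _.
  by rewrite pd_Gamma// christoffel_sym christoffel_Y !eqxx /=; ring.
- apply: big1 => k _; rewrite sumrB (bigD1 Y)//= big1 ?addr0; last first.
    by move=> l /negbTE lY; rewrite !GammaE christoffel_YY lY /=; ring.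
  rewrite (bigD1 k)//= big1 ?addr0; last first.
    move=> l /negbTE lk; rewrite !GammaE [christoffel k Y l]christoffel_sym.
    by rewrite (christoffel_Y k l) [k == l]eq_sym lk /=; ring.
  rewrite !GammaE [christoffel k Y k]christoffel_sym !christoffel_Y !eqxx Y_neq_T.
  by case: (k != T) => /=; ring.
Qed.

Lemma Hess_T (F : V -> R) (i : 'I_n.+1) (p : V) : Hess F i T p = pd i (pd T F) p.
Proof.
rewrite /Hess big1 ?subr0// => k _.
by rewrite GammaE christoffel_T !mul0r.
Qed.

Lemma Hess_YY (F : V -> R) (p : V) :
  Hess F Y Y p = pd Y (pd Y F) p + (xn p)^-1 * pd Y F p.
Proof.
rewrite /Hess (bigD1 Y)//= big1 ?addr0.
  by rewrite GammaE christoffel_YY eqxx /=; ring.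
by move=> k /negbTE kY; rewrite GammaE christoffel_YY kY /=; ring.
Qed.

End Geometry.

(** * Derivatives and constancy along coordinate lines of the half-space *)

Section Lines.
Variables (R : realType) (n : nat).
Hypothesis n_gt0 : (0 < n)%N.
Local Notation V := 'rV[R]_(n.+1).
Local Notation Y := (inord n.-1 : 'I_n.+1).
Local Notation T := (@ord_max n).
Local Notation e := (@ecoord R n).

Lemma is_derive_line (F : V -> R) (i : 'I_n.+1) (p : V) (s : R) :
  derivable F (s *: e i + p) (e i) ->
  is_derive s 1 (fun r : R => F (r *: e i + p)) (pd i F (s *: e i + p)).
Proof.
have E : (fun h : R => h^-1 *: ((F \o shift (s *: e i + p)) (h *: e i) - F (s *: e i + p)))
       = (fun h : R => h^-1 *: (((fun r : R => F (r *: e i + p)) \o shift s) (h *: (1 : R))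
           - F (s *: e i + p))).
  by apply/funext => h /=; rewrite addrA -scalerDl /GRing.scale /= mulr1.
by rewrite /derivable E => dF; apply: DeriveDef => //; rewrite /pd /derive E.
Qed.

Lemma line_segment_const (F : V -> R) (i : 'I_n.+1) (p : V) (s : R) :
  (forall r : R, Hdom (r *: e i + p) -> is_derive r 1 (fun r => F (r *: e i + p)) 0) ->
  Hdom p -> Hdom (s *: e i + p) -> F (s *: e i + p) = F p.
Proof.
move=> dF; rewrite {1 2}/Hdom /= xn_line => p0 sp0.
have seg a b : a <= b -> (forall x, a <= x <= b -> 0 < x * (i == Y)%:R + xn p) ->
    F (b *: e i + p) = F (a *: e i + p).
  move=> ab pos; apply/eqP; rewrite -subr_eq0; apply/eqP.
  have [|c _ ->] := @mean_value _ (fun r => F (r *: e i + p)) (cst 0) _ _ ab.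
    by move=> x xab; apply: dF; rewrite /Hdom /= xn_line pos.
  by rewrite /= mul0r.
rewrite -[in RHS](add0r p) -[in RHS](scale0r (e i)).
(* [xn] is affine along the line, so positivity at both ends gives it in between. *)
by have [s0|/ltW s0] := leP 0 s; [|apply/esym]; apply: seg => // x /andP[];
  move: sp0; case: (i == Y) => /=; lra.
Qed.

(* The coordinates of [p] are changed into those of [q] one at a time. *)
Lemma const_on_slices (F : V -> R) :
  (forall (i : 'I_n.+1) (p : V) (r : R), i != T -> Hdom (r *: e i + p) ->
     is_derive r 1 (fun r => F (r *: e i + p)) 0) ->
  forall p q, Hdom p -> Hdom q -> tco p = tco q -> F p = F q.
Proof.
move=> dF p q p0 q0 pq.
pose P k : V := \row_j (if (j < k)%N then q ord0 j else p ord0 j).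
have P0 k : Hdom (P k) by rewrite /Hdom /= /xn mxE; case: ifP.
suff FP k : (k <= n.+1)%N -> F (P k) = F p.
  rewrite -(FP n.+1)//; congr F; apply/rowP => j.
  by rewrite mxE ltn_ord.
elim: k => [|k IH] kn.
  by congr F; apply/rowP => j; rewrite mxE.
rewrite -IH ?(ltnW kn)//; pose i := Ordinal kn.
have PS : P k.+1 = (q ord0 i - p ord0 i) *: e i + P k.
  apply/rowP => j; rewrite !mxE -val_eqE /= ltnS leq_eqVlt eq_sym.
  have [ji|ji] /= := eqVneq k j; last by rewrite mulr0 add0r.
  have -> : j = i by apply: val_inj.
  by rewrite ltnn; ring.
(* Nothing moves in the [T] step, since [p] and [q] share that coordinate. *)
have [iT|iT] := eqVneq i T.
  by rewrite PS iT [p _ _]pq subrr scale0r add0r.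
rewrite PS; apply: line_segment_const => //; last by rewrite -PS.
by move=> r; apply: dF.
Qed.

End Lines.

(** * The linearised equation for [u], the value of [lambda], and the form of [u] *)

Section QuasiEinstein.
Variables (R : realType) (n : nat).
Hypothesis n_gt0 : (0 < n)%N.
Variables (m lambda : R) (f : 'rV[R]_(n.+1) -> R).
Hypotheses (m_gt0 : 0 < m) (hf : smooth_on f) (hqe : quasi_einstein m lambda f).
Local Notation V := 'rV[R]_(n.+1).
Local Notation Y := (inord n.-1 : 'I_n.+1).
Local Notation T := (@ord_max n).
Local Notation e := (@ecoord R n).

Lemma Hdom_xn_neq0 (p : V) : Hdom p -> xn p != 0.
Proof. by rewrite /Hdom /= => /gt_eqF ->. Qed.

Definition qe_u (p : V) : R := expR (- f p / m).
(** The chain-rule formula for the partial derivative of [qe_u], explicit so that it can be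
    differentiated again. *)
Definition qe_du (i : 'I_n.+1) (p : V) : R := - pd i f p / m * qe_u p.

Lemma qe_u_gt0 p : 0 < qe_u p.
Proof. exact: expR_gt0. Qed.

Lemma is_derive_qe_u (i : 'I_n.+1) (p : V) (s : R) : Hdom (s *: e i + p) ->
  is_derive s 1 (fun r : R => qe_u (r *: e i + p)) (qe_du i (s *: e i + p)).
Proof.
move=> q0; have df := is_derive_line ((hf [::] q0).2 i).
have h : is_derive s 1 (fun r => - f (r *: e i + p) / m) (- pd i f (s *: e i + p) / m).
  have h : is_derive s 1 (fun r => m^-1 * - f (r *: e i + p)) _ :=
    is_deriveZ m^-1 (is_deriveN df).
  rewrite (_ : (fun r => _) = (fun r => m^-1 * - f (r *: e i + p))).
    by apply: is_derive_eq h _; rewrite mulrC.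
  by apply/funext => r; rewrite mulrC.
have := is_derive1_comp (is_derive_expR _) h.
by rewrite mulrC.
Qed.

(** The product rule yields precisely the term in [df] tensor [df], so the bracket is the [f]-part
    of the equation up to Christoffel terms. *)
Lemma is_derive_qe_du (i j : 'I_n.+1) (p : V) (s : R) : Hdom (s *: e i + p) ->
  is_derive s 1 (fun r : R => qe_du j (r *: e i + p))
    (- (pd i (pd j f) (s *: e i + p)
        - m^-1 * (pd i f (s *: e i + p) * pd j f (s *: e i + p))) / m
     * qe_u (s *: e i + p)).
Proof.
move=> q0; have df := is_derive_line ((hf [:: j] q0).2 i).
have h : is_derive s 1 (fun r => - m^-1 * pd j f (r *: e i + p) * qe_u (r *: e i + p)) _ :=
  is_deriveM (is_deriveZ (- m^-1) df) (is_derive_qe_u q0).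
rewrite (_ : (fun r => _) = (fun r => - m^-1 * pd j f (r *: e i + p) * qe_u (r *: e i + p))).
  apply: is_derive_eq h _; rewrite /qe_du /=; move: (s *: e i + p) => q;
    rewrite !/GRing.scale /= /GRing.scale /=; ring.
by apply/funext => r; rewrite /qe_du; ring.
Qed.

Lemma is_derive_qe_du_T (i : 'I_n.+1) (p : V) (s : R) : Hdom (s *: e i + p) ->
  is_derive s 1 (fun r : R => qe_du T (r *: e i + p))
    (- (lambda * (i == T)%:R) / m * qe_u (s *: e i + p)).
Proof.
move=> q0; apply: is_derive_eq (is_derive_qe_du T q0) _.
have := hqe q0 i T; rewrite (Ric_T n_gt0 _ (Hdom_xn_neq0 q0)) Hess_T// add0r => ->.
by rewrite /gmet; case: eqVneq => [->|_] //; rewrite eqxx.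
Qed.

(** The mixed components make [qe_du T] a function of [t] alone. Its [t]-derivative is
    [- lambda / m * qe_u], and dividing by the nonzero factor transfers the property to [qe_u]. *)
Lemma qe_u_slices : lambda != 0 ->
  forall p q, Hdom p -> Hdom q -> tco p = tco q -> qe_u p = qe_u q.
Proof.
move=> l0.
have du_slices : forall p q, Hdom p -> Hdom q -> tco p = tco q -> qe_du T p = qe_du T q.
  apply: const_on_slices => // i p r iT q0.
  by apply: is_derive_eq (is_derive_qe_du_T q0) _; rewrite (negbTE iT) mulr0 oppr0 !mul0r.
have Hline (p : V) s : Hdom p -> Hdom (s *: e T + p).
  by rewrite /Hdom /= xn_line [T == Y]eq_sym Y_neq_T// mulr0 add0r.
move=> p q p0 q0 pq.
have dp := is_derive_qe_du_T (Hline _ 0 p0).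
have dq := is_derive_qe_du_T (Hline _ 0 q0).
have E : (fun r : R => qe_du T (r *: e T + p)) = (fun r : R => qe_du T (r *: e T + q)).
  by apply/funext => r; apply: du_slices; rewrite ?tco_line ?pq//; exact: Hline.
rewrite E in dp.
have := etrans (esym (@derive_val _ _ _ _ _ _ _ dp)) (@derive_val _ _ _ _ _ _ _ dq).
rewrite !scale0r !add0r => /mulfI; apply.
by rewrite eqxx mulr1 mulf_neq0 ?oppr_eq0 ?invr_eq0// gt_eqF.
Qed.

(* [s = ln x_n] is the arc length along the geodesic. *)
Lemma qe_u_geodesic (G := fun s : R => qe_u (expR s *: e Y + 0)) :
  exists2 H : R -> R, (forall s : R, is_derive s 1 G (H s)) &
    forall s : R, is_derive s 1 H (- (lambda + n.-1%:R) / m * G s).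
Proof.
have Hl (s : R) : Hdom (expR s *: e Y + 0).
  by rewrite /Hdom /= xn_line eqxx mulr1 /xn mxE addr0 expR_gt0.
(* The arc-length derivative is [xn] times the [xn]-derivative. *)
exists (fun s => expR s * qe_du Y (expR s *: e Y + 0)) => s.
  have := is_derive1_comp (is_derive_qe_u (Hl s)) (is_derive_expR s).
  by rewrite mulrC.
have dD := is_derive1_comp (is_derive_qe_du Y (Hl s)) (is_derive_expR s).
have h : is_derive s 1 (fun s => expR s * qe_du Y (expR s *: e Y + 0)) _ :=
  is_deriveM (is_derive_expR s) dD.
apply: is_derive_eq h _.
have xE : xn (expR s *: e Y + 0) = expR s.
  by rewrite xn_line eqxx mulr1 /xn mxE addr0.
have E0 := expR_gt0 s; rewrite /GRing.scale /= /G /qe_du.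
have := hqe (Hl s) Y Y; rewrite (Ric_YY n_gt0 (Hdom_xn_neq0 (Hl s))) Hess_YY// xE.
rewrite /gmet eqxx Y_neq_T// xE.
move: (pd Y _ _) (pd Y f _) (qe_u _) => f2 f1 u hq.
(* This exposes the right-hand side of the [(Y, Y)] component. The first-order term of [Hess_YY]
   then matches the one produced by differentiating [expR s]. *)
have -> : lambda = expR s ^+ 2 * (lambda * (expR s ^+ 2)^-1).
  by field; rewrite gt_eqF.
rewrite -hq; field; by rewrite !gt_eqF.
Qed.

Hypothesis n_gt1 : (1 < n)%N.

Lemma qe_lambda : lambda = - n.-1%:R.
Proof.
have [H dG dH] := qe_u_geodesic.
set G := fun s : R => _ in dG dH.
have n1 : 0 < n.-1%:R :> R by rewrite ltr0n -ltnS prednK.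
have l_le : lambda + n.-1%:R <= 0.
  rewrite leNgt; apply/negP => l0.
  apply: (positive_concave_absurd dG dH) => s; first exact: qe_u_gt0.
  by rewrite mulNr mulNr oppr_lt0 mulr_gt0 ?divr_gt0// qe_u_gt0.
(* The geodesic stays in the slice [t = 0], and [l_le] with [n1] gives [lambda < 0]. A constant
   positive [G] then annihilates the coefficient in its own equation. *)
have G_cst : G = cst (G 0).
  apply/funext => s; apply: qe_u_slices; first by rewrite lt_eqF//; lra.
  - by rewrite /Hdom /= xn_line eqxx mulr1 /xn mxE addr0 expR_gt0.
  - by rewrite /Hdom /= xn_line eqxx mulr1 /xn mxE addr0 expR_gt0.
  - by rewrite !tco_line Y_neq_T// !mulr0.
have H_cst : H = cst 0.
  apply/funext => s; rewrite -[LHS](@derive_val _ _ _ _ _ _ _ (dG s)).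
  by rewrite G_cst derive_cst.
have := @derive_val _ _ _ _ _ _ _ (dH 0).
rewrite H_cst derive_cst => /esym/eqP.
rewrite !mulf_eq0 oppr_eq0 invr_eq0 (gt_eqF m_gt0) (gt_eqF (qe_u_gt0 _)).
by rewrite !orbF addr_eq0 => /eqP.
Qed.

(** The ODE is solved on the single vertical line through [e Y], where [xn = 1]; constancy on slices
    extends the formula to the whole domain. *)
Lemma qe_u_exp (eta := Num.sqrt (n.-1%:R / m)) :
  exists a b : R, forall p, Hdom p ->
    qe_u p = a * expR (eta * tco p) + b * expR (- (eta * tco p)).
Proof.
have n1 : 0 < n.-1%:R :> R by rewrite ltr0n -ltnS prednK.
have eta2 : eta ^+ 2 = n.-1%:R / m by rewrite sqr_sqrtr// divr_ge0// ltW.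
have Hl (t : R) : Hdom (t *: e T + e Y).
  by rewrite /Hdom /= xn_line [T == Y]eq_sym Y_neq_T// mulr0 add0r /xn mxE eqxx ltr01.
have eta0 : eta != 0 by rewrite sqrtr_eq0 -ltNge divr_gt0.
pose B (t : R) := qe_u (t *: e T + e Y).
have dB1 (t : R) : is_derive t 1 (fun t : R => qe_du T (t *: e T + e Y)) (eta ^+ 2 * B t).
  apply: is_derive_eq (is_derive_qe_du_T (Hl t)) _.
  by rewrite eta2 qe_lambda eqxx mulr1 opprK.
have [a [b uE]] := second_order_ode eta0 (fun t => is_derive_qe_u (Hl t)) dB1.
exists a, b => p p0; rewrite -uE; apply: qe_u_slices => //.
  by rewrite qe_lambda oppr_eq0 gt_eqF.
by rewrite tco_line eqxx mulr1 /tco mxE Y_neq_T// addr0.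
Qed.

End QuasiEinstein.

(** * Return from [u] to [f], and the three families *)

Theorem theorem1 (R : realType) (n : nat) (hn : (2 <= n)%N) (m : R) (hm : 0 < m)
  (f : 'rV[R]_(n.+1) -> R) (lambda : R)
  (hf : smooth_on f) (hqe : quasi_einstein m lambda f) :
  lambda = - (n.-1)%:R /\
  ((exists c : R, forall p, Hdom p -> f p = Num.sqrt ((n.-1)%:R * m) * tco p + c)
   \/ (exists c : R, forall p, Hdom p -> f p = - Num.sqrt ((n.-1)%:R * m) * tco p + c)
   \/ (exists a c : R, forall p, Hdom p ->
         f p = - m * ln (cosh (Num.sqrt ((n.-1)%:R / m) * tco p + a)) + c)).
Proof.
have n_gt0 : (0 < n)%N := ltnW hn.
split; first exact: (qe_lambda n_gt0 hm hf hqe hn).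
have [a [b]] := qe_u_exp n_gt0 hm hf hqe hn.
set eta := Num.sqrt (_ / _) => uE.
have m0 : m != 0 by rewrite gt_eqF.
have n1 : 0 < n.-1%:R :> R by rewrite ltr0n -ltnS prednK.
have eta0 : eta != 0 by rewrite sqrtr_eq0 -ltNge divr_gt0.
have etam : Num.sqrt (n.-1%:R * m) = m * eta.
  rewrite /eta (_ : n.-1%:R * m = m ^+ 2 * (n.-1%:R / m)); last by field.
  by rewrite sqrtrM ?sqr_ge0// sqrtr_sqr ger0_norm// ltW.
have fE p : Hdom p -> f p = - m * ln (a * expR (eta * tco p) + b * expR (- (eta * tco p))).
  by move=> p0; rewrite -uE// expRK; field.
(* Every real [t] is the last coordinate of a point with [xn = 1], so positivity of [u] holds for
   all [t]. *)
have pos t : 0 < a * expR (eta * t) + b * expR (- (eta * t)).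
  pose p : 'rV[R]_n.+1 := t *: ecoord R ord_max + ecoord R (inord n.-1).
  have p0 : Hdom p.
    by rewrite /Hdom /= xn_line [_ == inord _]eq_sym Y_neq_T// mulr0 add0r /xn mxE eqxx ltr01.
  have -> : t = tco p by rewrite tco_line eqxx mulr1 /tco mxE Y_neq_T// addr0.
  by rewrite -uE// qe_u_gt0.
have a0 : 0 <= a := exp_combination_coef_ge0 eta0 pos.
have b0 : 0 <= b.
  (* Reversing the sign of [eta] exchanges the two coefficients. *)
  apply: (@exp_combination_coef_ge0 R (- eta) b a); first by rewrite oppr_eq0.
  by move=> t; rewrite mulNr opprK addrC.
rewrite etam; move: a0 b0; rewrite !le_eqVlt => /predU1P[a0|a0] /predU1P[b0|b0].
- by have := pos 0; rewrite -a0 -b0 !mul0r addr0 ltxx.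
(* With [a = 0] only the decaying exponential remains, and [- m * ln] turns it into slope
   [+ m * eta]. *)
- left; exists (- m * ln b) => p p0.
  rewrite fE// -a0 mul0r add0r lnM ?posrE ?expR_gt0// expRK; ring.
- right; left; exists (- m * ln a) => p p0.
  rewrite fE// -b0 mul0r addr0 lnM ?posrE ?expR_gt0// expRK; ring.
- right; right; exists (ln (Num.sqrt a) - ln (Num.sqrt b)).
  exists (- m * ln (2 * (Num.sqrt a * Num.sqrt b))) => p p0.
  rewrite fE// ln_exp_combination//; ring.
Qed.
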